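(* Let $A$ be a vector space with two bilinear operations $\succ,\prec$, and let $(A,\vartriangleright,\vartriangleleft)$ be its $-2$-algebra, i.e. $$x\vartriangleright y=x\succ y-2\,x\prec y,\qquad x\vartriangleleft y=x\prec y-2\,x\succ y,\qquad\forall x,y\in A.$$ Then $(A,\succ,\prec)$ is a Novikov-type dendriform algebra if and only if $(A,\vartriangleright,\vartriangleleft)$ is an admissible Novikov-type dendriform algebra.
   Context: All vector spaces are finite-dimensional over a field $\mathbb F$ of characteristic $0$. Dendriform algebra: a vector space $A$ with two bilinear operations $\succ,\prec$ such that, with $x\cdot y=x\succ y+x\prec y$, for all $x,y,z\in A$, $$x\succ(y\succ z)=(x\cdot y)\succ z,\qquad (x\prec y)\prec z=x\prec(y\cdot z),\qquad (x\succ y)\prec z=x\succ(y\prec z).$$ Novikov-type dendriform algebra: a dendriform algebra $(A,\succ,\prec)$ with, for all $x,y,z\in A$, $x\succ(y\succ z)=(x\prec y)\prec z$, $(x\prec y)\succ z=x\prec(y\succ z)$ and $x\prec(y\prec z)=0$. Anti-dendriform algebra: a vector space $A$ with two bilinear operations $\vartriangleright,\vartriangleleft$ such that, with $x\cdot y=x\vartriangleright y+x\vartriangleleft y$, for all $x,y,z\in A$, $$x\vartriangleright(y\vartriangleright z)=-(x\cdot y)\vartriangleright z=-x\vartriangleleft(y\cdot z)=(x\vartriangleleft y)\vartriangleleft z,\qquad (x\vartriangleright y)\vartriangleleft z=x\vartriangleright(y\vartriangleleft z).$$ Admissible Novikov-type dendriform algebra: an anti-dendriform algebra $(A,\vartriangleright,\vartriangleleft)$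 with, for all $x,y,z\in A$, $(x\vartriangleleft y)\vartriangleright z=x\vartriangleleft(y\vartriangleright z)$ and $x\vartriangleleft(y\vartriangleleft z)=2(x\cdot y)\vartriangleleft z$, where $x\cdot y=x\vartriangleright y+x\vartriangleleft y$. *)

(* Defs.v *)
From HB Require Import structures.
From mathcomp Require Import all_boot all_order all_algebra.
Set Implicit Arguments.
Unset Strict Implicit.
Unset Printing Implicit Defensive.
Import GRing.Theory.
Local Open Scope ring_scope.

Section DendriformAlgebras.
Variables (F : fieldType) (A : vectType F).
Implicit Types succ prec rhd lhd : {bilinear A -> A -> A}.

Definition sum_op (f g : A -> A -> A) (x y : A) : A := f x y + g x y.

Record dendriform succ prec : Prop := Dendriform {
  dendriform_succ : forall x y z,
    succ x (succ y z) = succ (sum_op succ prec x y) z;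
  dendriform_prec : forall x y z,
    prec (prec x y) z = prec x (sum_op succ prec y z);
  dendriform_mid : forall x y z,
    prec (succ x y) z = succ x (prec y z)
}.

Record novikov_dendriform succ prec : Prop := NovikovDendriform {
  novikov_dendriform_base : dendriform succ prec;
  novikov_dendriform_diag : forall x y z,
    succ x (succ y z) = prec (prec x y) z;
  novikov_dendriform_mid : forall x y z,
    succ (prec x y) z = prec x (succ y z);
  novikov_dendriform_nil : forall x y z,
    prec x (prec y z) = 0
}.

Record anti_dendriform rhd lhd : Prop := AntiDendriform {
  anti_dendriform_rhd : forall x y z,
    rhd x (rhd y z) = - rhd (sum_op rhd lhd x y) z;
  anti_dendriform_sum : forall x y z,
    - rhd (sum_op rhd lhd x y) z = - lhd x (sum_op rhd lhd y z);
  anti_dendriform_lhd : forall x y z,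
    - lhd x (sum_op rhd lhd y z) = lhd (lhd x y) z;
  anti_dendriform_mid : forall x y z,
    lhd (rhd x y) z = rhd x (lhd y z)
}.

Record admissible_novikov_dendriform rhd lhd : Prop :=
  AdmissibleNovikovDendriform {
  admissible_novikov_dendriform_base : anti_dendriform rhd lhd;
  admissible_novikov_dendriform_mid : forall x y z,
    rhd (lhd x y) z = lhd x (rhd y z);
  admissible_novikov_dendriform_lhd : forall x y z,
    lhd x (lhd y z) = 2 *: lhd (sum_op rhd lhd x y) z
}.

(* The -2-algebra of (succ, prec) has the two operations
   m2_op succ prec and m2_op prec succ. *)
Definition m2_op (f g : A -> A -> A) (x y : A) : A := f x y - 2 *: g x y.

Fact m2_op_is_bilinear (f g : {bilinear A -> A -> A}) :
  bilinear_for *:%R *:%R (m2_op f g).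
Proof.
split=> [u' | u] a x y; rewrite /m2_op /=.
- by rewrite !linearPl /= scalerDr scalerBr opprD addrACA !scalerA mulrC.
- by rewrite !linearPr /= scalerDr scalerBr opprD addrACA !scalerA mulrC.
Qed.

HB.instance Definition _ (f g : {bilinear A -> A -> A}) :=
  bilinear_isBilinear.Build F A A A *:%R *:%R (m2_op f g)
    (m2_op_is_bilinear f g).

End DendriformAlgebras.

(* Main.v *)
Require Import Defs.
From mathcomp Require Import all_boot all_order all_algebra.
From mathcomp Require Import ring.
Import GRing.Theory.
Local Open Scope ring_scope.

(** For fixed x, y, z an algebra with two operations has eight triple products,
four of the form (x y) z and four of the form x (y z).  The Novikov-type
dendriform axioms are six linear relations between them, which leave two of
them, s = (x succ y) prec z and t = x succ (y succ z), free
([novikov_dendriformP]).  The admissible axioms are six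
linear relations between the triple products of the other two operations,
which again leave two, a = x rhd (y rhd z) and b = x rhd (y lhd z), free
([admissible_novikov_dendriformP]).

Passing to the -2-algebra is linear on operations, and it is undone up to the
scalar -3, because (1 - 2 w) (1 + 2 w) = -3 for the swap w of the two
operations.  It therefore acts linearly on triple products
([m2_op_left], [m2_op_right]) and is undone there up to the scalar 9
([m2_op_leftK], [m2_op_rightK]), which is invertible in characteristic 0.  The
two solution spaces correspond under this map, through
a = - (t + 2 s) and b = s + 2 t, or 3 s = - (2 a + b) and 3 t = a + 2 b. *)

Section LinearIdentities.
Context {F : fieldType} {A : vectType F}.

Lemma eq_linear_forms (u v : A) :
  (forall phi : {linear A -> F^o}, phi u = phi v) -> u = v.
Proof.
move=> eq_uv; rewrite (coord_vbasis (memvf u)) (coord_vbasis (memvf v)).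
by apply: eq_bigr => i _; rewrite eq_uv.
Qed.

Lemma scalar_linearZ (phi : {linear A -> F^o}) (c : F) (u : A) :
  phi (c *: u) = c * phi u.
Proof. exact: linearZ. Qed.

End LinearIdentities.

(** Identities between linear combinations of vectors are checked under an
arbitrary linear form, which turns them into identities of scalars. *)
Ltac linear_identity :=
  apply: eq_linear_forms => phi;
  rewrite ?(linearD, linearN, linear0, scalar_linearZ) /=;
  first [ring | by field].

Section TripleProducts.
Context {F : fieldType} {A : vectType F}.
Implicit Types (f g h k : {bilinear A -> A -> A}) (x y z : A).

Lemma m2_op_left f g h k x y z :
  m2_op f g (m2_op h k x y) z =
  f (h x y) z - 2 *: f (k x y) z - 2 *: g (h x y) z + 4 *: g (k x y) z.
Proof.
rewrite /m2_op !(linearBl, linearZl_LR) /=; linear_identity.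
Qed.

Lemma m2_op_right f g h k x y z :
  m2_op f g x (m2_op h k y z) =
  f x (h y z) - 2 *: f x (k y z) - 2 *: g x (h y z) + 4 *: g x (k y z).
Proof.
rewrite /m2_op !(linearBr, linearZr_LR) /=; linear_identity.
Qed.

(** With w the swap of the two operations, the -2-algebra construction is
1 - 2 w, and 1 + 2 w inverts it up to -3.  A triple product involves two
operations, hence the factor 9 = (-3)^2. *)
Lemma m2_op_leftK f g h k x y z :
  9 *: f (h x y) z =
  m2_op f g (m2_op h k x y) z + 2 *: m2_op f g (m2_op k h x y) z
  + 2 *: m2_op g f (m2_op h k x y) z + 4 *: m2_op g f (m2_op k h x y) z.
Proof. rewrite !m2_op_left; linear_identity. Qed.

Lemma m2_op_rightK f g h k x y z :
  9 *: f x (h y z) =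
  m2_op f g x (m2_op h k y z) + 2 *: m2_op f g x (m2_op k h y z)
  + 2 *: m2_op g f x (m2_op h k y z) + 4 *: m2_op g f x (m2_op k h y z).
Proof. rewrite !m2_op_right; linear_identity. Qed.

End TripleProducts.

Section SolvedAxioms.
Context {F : fieldType} {A : vectType F}.
Implicit Types (succ prec rhd lhd : {bilinear A -> A -> A}).

Definition novikov_triple (succ prec : A -> A -> A) (x y z s t : A) : Prop :=
  [/\ succ (succ x y) z = 0, prec (succ x y) z = s,
      succ (prec x y) z = t & prec (prec x y) z = t] /\
  [/\ succ x (succ y z) = t, succ x (prec y z) = s,
      prec x (succ y z) = t & prec x (prec y z) = 0].

Definition admissible_triple (rhd lhd : A -> A -> A) (x y z a b : A) : Prop :=
  [/\ rhd (rhd x y) z = 2 *: (a + b), lhd (rhd x y) z = b,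
      rhd (lhd x y) z = - (3 *: a + 2 *: b) & lhd (lhd x y) z = a] /\
  [/\ rhd x (rhd y z) = a, rhd x (lhd y z) = b,
      lhd x (rhd y z) = - (3 *: a + 2 *: b) & lhd x (lhd y z) = 2 *: (a + b)].

(** The value 0 of (x succ y) succ z comes from comparing x succ (y succ z) =
(x succ y) succ z + (x prec y) succ z with the equality of x succ (y succ z)
and (x prec y) succ z, both being equal to x prec (y succ z) because
x prec (y prec z) = 0. *)
Lemma novikov_dendriformP succ prec :
  novikov_dendriform succ prec <->
  forall x y z, exists s t, novikov_triple succ prec x y z s t.
Proof.
split=> [[[ss pp sp] diag mid nil] x y z | solved].
- exists (prec (succ x y) z), (succ x (succ y z)).
  move: (ss x y z) (pp x y z); rewrite /sum_op linearDl linearDr /= nil addr0.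
  rewrite -diag => ss_eq pp_eq.
  have ps_eq : succ (prec x y) z = succ x (succ y z) by rewrite mid -pp_eq.
  have ss0 : succ (succ x y) z = 0.
    by apply: (addIr (succ (prec x y) z)); rewrite -ss_eq ps_eq add0r.
  by split; split.
- split; first split; move=> x y z; have [s [t]] := solved x y z;
    case=> [[lss lsp lps lpp] [rss rsp rps rpp]];
    rewrite /sum_op ?linearDl ?linearDr /=.
  + by rewrite rss lss lps add0r.
  + by rewrite lpp rps rpp addr0.
  + by rewrite lsp rsp.
  + by rewrite rss lpp.
  + by rewrite lps rps.
  + by [].
Qed.

(** The axioms give x lhd (y lhd z) = 2 (a + b) at once, a being also the value
of (x lhd y) lhd z.  The two anti-dendriform sums, each equal to - a, then
determine the three remaining triple products. *)
Lemma admissible_novikov_dendriformP rhd lhd :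
  admissible_novikov_dendriform rhd lhd <->
  forall x y z, exists a b, admissible_triple rhd lhd x y z a b.
Proof.
split=> [[[rr sum ll rl] mid dbl] x y z | solved].
- exists (rhd x (rhd y z)), (rhd x (lhd y z)).
  move: (rr x y z) (sum x y z) (ll x y z) (dbl x y z).
  rewrite /admissible_triple /sum_op !linearDl linearDr /= rl mid.
  move=> rr_eq sum_eq ll_eq dbl_eq.
  have ll_rr : lhd (lhd x y) z = rhd x (rhd y z) by rewrite rr_eq sum_eq.
  rewrite ll_rr in ll_eq dbl_eq.
  move: (rhd x (rhd y z)) (rhd x (lhd y z)) rr_eq sum_eq ll_rr ll_eq dbl_eq.
  move=> a b rr_eq _ ll_rr ll_eq dbl_eq.
  have lr_eq : lhd x (rhd y z) = - (3 *: a + 2 *: b).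
    transitivity (- a - lhd x (lhd y z)).
      by rewrite -ll_eq opprK addrK.
    by rewrite dbl_eq; linear_identity.
  have rr_val : rhd (rhd x y) z = 2 *: (a + b).
    transitivity (- a - lhd x (rhd y z)); first by rewrite rr_eq opprK addrK.
    by rewrite lr_eq; linear_identity.
  by split; split=> //; rewrite dbl_eq addrC.
- split; first split; move=> x y z; have [a [b]] := solved x y z;
    case=> [[lrr lrl llr lll] [rrr rrl rlr rll]];
    rewrite /sum_op ?linearDl ?linearDr /=
      ?(lrr, lrl, llr, lll, rrr, rrl, rlr, rll); linear_identity.
Qed.

End SolvedAxioms.

Section Correspondence.
Context {F : fieldType} {A : vectType F}.
Context {succ prec : {bilinear A -> A -> A}} {x y z : A}.

Lemma novikov_triple_m2 {s t : A} :
  novikov_triple succ prec x y z s t ->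
  admissible_triple (m2_op succ prec) (m2_op prec succ) x y z
    (- (t + 2 *: s)) (s + 2 *: t).
Proof.
case=> [[lss lsp lps lpp] [rss rsp rps rpp]].
by split; split; rewrite ?m2_op_left ?m2_op_right
  ?(lss, lsp, lps, lpp, rss, rsp, rps, rpp); linear_identity.
Qed.

(** The values of s and t solve a = - (t + 2 s), b = s + 2 t, a system of
determinant -3. *)
Lemma admissible_triple_m2 {a b : A} (three_neq0 : 3 != 0 :> F) :
  admissible_triple (m2_op succ prec) (m2_op prec succ) x y z a b ->
  novikov_triple succ prec x y z
    (- 3^-1 *: (2 *: a + b)) (3^-1 *: (a + 2 *: b)).
Proof.
case=> [[lrr lrl llr lll] [rrr rrl rlr rll]].
have nine_neq0 : 9 != 0 :> F by rewrite (natrM _ 3 3) mulf_neq0.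
(* The operation k of [m2_op_leftK] and [m2_op_rightK] does not occur on their
   left-hand sides, so each instance is given in full. *)
by split; split; apply: (scalerI nine_neq0);
  rewrite ?(m2_op_leftK succ prec succ prec, m2_op_leftK succ prec prec succ,
    m2_op_leftK prec succ succ prec, m2_op_leftK prec succ prec succ,
    m2_op_rightK succ prec succ prec, m2_op_rightK succ prec prec succ,
    m2_op_rightK prec succ succ prec, m2_op_rightK prec succ prec succ)
  ?(lrr, lrl, llr, lll, rrr, rrl, rlr, rll); linear_identity.
Qed.

End Correspondence.

Theorem corollary3p12 (F : fieldType) (charF0 : [pchar F] =i pred0)
    (A : vectType F) (succ prec : {bilinear A -> A -> A}) :
  novikov_dendriform succ prec <->
  admissible_novikov_dendriform (m2_op succ prec) (m2_op prec succ).
Proof.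
have three_neq0 : 3 != 0 :> F by rewrite ((pcharf0P F).1 charF0).
rewrite novikov_dendriformP admissible_novikov_dendriformP.
split=> solved x y z.
- have [s [t /novikov_triple_m2 st_ab]] := solved x y z.
  by exists (- (t + 2 *: s)), (s + 2 *: t).
- have [a [b /(admissible_triple_m2 three_neq0) ab_st]] := solved x y z.
  by exists (- 3^-1 *: (2 *: a + b)), (3^-1 *: (a + 2 *: b)).
Qed.
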